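(* Let $Y$ be a topological vector space, let $A$ be a closed proper subset of $Y$, let $k\in-0^+A\setminus\{0\}$, and let $\lambda\in\mathbb{R}$, $\lambda>0$. Then $\lambda k\in-0^+A\setminus\{0\}$, $\operatorname{dom}\varphi_{A,\lambda k}=\operatorname{dom}\varphi_{A,k}$ and $$\varphi_{A,\lambda k}(y)=\frac1\lambda\varphi_{A,k}(y)\quad\forall y\in Y.$$ $\varphi_{A,\lambda k}$ is proper, finite-valued, continuous, lower semicontinuous, upper semicontinuous, convex, concave, strictly quasiconvex, subadditive, superadditive, affine, linear, sublinear, positively homogeneous, odd and homogeneous, respectively, if and only if $\varphi_{A,k}$ has this property. If $B\subset Y$, then $\varphi_{A,\lambda k}$ is $B$-monotone and strictly $B$-monotone, respectively, if $\varphi_{A,k}$ has this property.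
   Context: Vector spaces are real. ''Proper subset of $Y$'' means nonempty and different from $Y$. $0^+A=\{u\in Y\mid a+tu\in A\ \forall a\in A,\ \forall t\ge0\}$. $\nu$ is a symbolic value not in $\overline{\mathbb{R}}=\mathbb{R}\cup\{\pm\infty\}$, not comparable with elements of $\overline{\mathbb{R}}$, with $-\nu=\nu$ and $c\nu=\nu$ for real $c$; $\inf\emptyset:=\nu$. $\varphi_{A,k}:Y\to\overline{\mathbb{R}}\cup\{\nu\}$, $\varphi_{A,k}(y)=\inf\{t\in\mathbb{R}\mid y\in tk+A\}$. For $\varphi:Y\to\overline{\mathbb{R}}\cup\{\nu\}$: $\operatorname{dom}\varphi=\{y\mid\varphi(y)\in\overline{\mathbb{R}}\}$ (for $\varphi_{A,k}$ the value $+\infty$ does not occur) and $\operatorname{epi}\varphi=\{(y,t)\in Y\times\mathbb{R}\mid y\in\operatorname{dom}\varphi,\varphi(y)\le t\}$. $\varphi$ is: proper if $\operatorname{dom}\varphi\neq\emptyset$ and it is real-valued on $\operatorname{dom}\varphi$; finite-valued if real-valued on $Y$; (lower/upper semi-)continuous if its restriction to $\operatorname{dom}\varphi$, as a map into $\overline{\mathbb{R}}$, is so; convex if $\operatorname{dom}\varphi$ and $\operatorname{epi}\varphi$ are convex; subadditive if $\operatorname{dom}\varphi+\operatorname{dom}\varphi\subseteq\operatorname{dom}\varphi$ and $\operatorname{epi}\varphi+\operatorname{epi}\varphi\subseteq\operatorname{epi}\varphi$; positively homogeneous if $\operatorname{dom}\varphi$ and $\operatorname{epi}\varphi$ are nonempty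 cones (closed under multiplication by all $\lambda\ge0$); sublinear if convex and positively homogeneous; concave (superadditive) if $-\varphi$ is convex (subadditive); affine if convex and concave; linear if it is a linear map $Y\to\mathbb{R}$; odd if $\operatorname{dom}\varphi=-\operatorname{dom}\varphi$ and $\varphi(-y)=-\varphi(y)$ on $\operatorname{dom}\varphi$; homogeneous if for all $y\in\operatorname{dom}\varphi$, $c\in\mathbb{R}$: $cy\in\operatorname{dom}\varphi$ and $\varphi(cy)=c\varphi(y)$ (with $0\cdot(\pm\infty)=0$); strictly quasiconvex if $\operatorname{dom}\varphi$ is convex and $\varphi(cy^1+(1-c)y^2)<\max(\varphi(y^1),\varphi(y^2))$ for all distinct $y^1,y^2\in\operatorname{dom}\varphi$, $c\in(0,1)$. $\varphi$ is $B$-monotone if $y^1,y^2\in\operatorname{dom}\varphi$, $y^2-y^1\in B$ imply $\varphi(y^1)\le\varphi(y^2)$; strictly $B$-monotone if $y^1,y^2\in\operatorname{dom}\varphi$, $y^2-y^1\in B\setminus\{0\}$ imply $\varphi(y^1)<\varphi(y^2)$. *)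

(* Defs.v *)
From HB Require Import structures.
From mathcomp Require Import all_boot all_order all_algebra.
From mathcomp Require Import all_classical all_reals all_analysis.
Set Implicit Arguments.
Unset Strict Implicit.
Unset Printing Implicit Defensive.
Import Order.TTheory GRing.Theory Num.Theory.
Import numFieldNormedType.Exports.
Local Open Scope classical_set_scope.
Local Open Scope ring_scope.

Section nu_values.
Variable R : realType.

(* The extended reals with the extra symbolic value nu. Being an element of
   [option], nu carries no order relation with the elements of [\bar R]. *)
Definition nubar : Type := option (\bar R).
Definition nu : nubar := None.

Definition nu_opp (x : nubar) : nubar := omap oppe x.

(* [mule] satisfies 0 * +oo = 0 * -oo = 0, and c * nu = nu for every c. *)
Definition nu_scale (c : R) (x : nubar) : nubar := omap (mule c%:E) x.

Definition nu_inf (S : set R) : nubar :=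
  if pselect (S = set0) then nu else Some (ereal_inf (EFin @` S)).

End nu_values.

Section nu_functions.
Variables (R : realType) (Y : topologicalLmodType R).
Implicit Types (phi : Y -> nubar R) (A B : set Y) (k : Y).

Definition proper_subset A : Prop := A !=set0 /\ A <> [set: Y].

Definition recession_cone A : set Y :=
  [set u | forall a, A a -> forall t : R, 0 <= t -> A (a + t *: u)].

Definition phi_of A k : Y -> nubar R :=
  fun y => nu_inf [set t : R | [set t *: k + a | a in A] y].

Definition dom phi : set Y := [set y | exists x : \bar R, phi y = Some x].

(* The value of phi on its domain; the default 0 outside [dom phi] is junk. *)
Definition fval phi (y : Y) : \bar R := odflt 0%E (phi y).

Definition epi phi : set (Y * R^o) :=
  [set p | dom phi p.1 /\ (fval phi p.1 <= (p.2)%:E)%E].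

Definition opp_fun phi : Y -> nubar R := fun y => nu_opp (phi y).

Definition nu_proper phi : Prop :=
  dom phi !=set0 /\ (forall y, dom phi y -> fval phi y \is a fin_num).

Definition nu_finite_valued phi : Prop :=
  forall y, exists r : R, phi y = Some r%:E.

Definition nu_continuous phi : Prop := {within dom phi, continuous (fval phi)}.

(* In [subspace (dom phi)] every point outside [dom phi] is isolated, so
   semicontinuity on this space is semicontinuity of the restriction of phi
   to its domain. *)
Definition nu_lsc phi : Prop :=
  lower_semicontinuous (fval phi : subspace (dom phi) -> \bar R).

Definition upper_semicontinuous (X : topologicalType) (f : X -> \bar R) : Prop :=
  forall x (a : R), (f x < a%:E)%E ->
    exists2 V, nbhs x V & forall y, V y -> (f y < a%:E)%E.

Definition nu_usc phi : Prop :=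
  upper_semicontinuous (fval phi : subspace (dom phi) -> \bar R).

Definition nu_convex phi : Prop :=
  convex_set (M := Y) (dom phi) /\
  convex_set (M := (Y * R^o)%type) (epi phi).

Definition nu_concave phi : Prop := nu_convex (opp_fun phi).

Definition nu_subadditive phi : Prop :=
  [set u + v | u in dom phi & v in dom phi] `<=` dom phi /\
  [set p + q | p in epi phi & q in epi phi] `<=` epi phi.

Definition nu_superadditive phi : Prop := nu_subadditive (opp_fun phi).

Definition cone (V : lmodType R) (S : set V) : Prop :=
  forall (c : R) (u : V), 0 <= c -> S u -> S (c *: u).

Definition nu_pos_homogeneous phi : Prop :=
  (dom phi !=set0 /\ cone (dom phi)) /\ (epi phi !=set0 /\ cone (epi phi)).

Definition nu_sublinear phi : Prop := nu_convex phi /\ nu_pos_homogeneous phi.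

Definition nu_affine phi : Prop := nu_convex phi /\ nu_concave phi.

Definition nu_linear phi : Prop :=
  exists f : {linear Y -> R^o}, forall y, phi y = Some (f y)%:E.

Definition nu_odd phi : Prop :=
  dom phi = [set - y | y in dom phi] /\
  (forall y, dom phi y -> phi (- y) = nu_opp (phi y)).

Definition nu_homogeneous phi : Prop :=
  forall y (c : R), dom phi y ->
    dom phi (c *: y) /\ phi (c *: y) = nu_scale c (phi y).

Definition nu_strictly_quasiconvex phi : Prop :=
  convex_set (M := Y) (dom phi) /\
  forall (y1 y2 : Y) (c : R), dom phi y1 -> dom phi y2 -> y1 <> y2 ->
    0 < c -> c < 1 ->
    (fval phi (c *: y1 + (1 - c) *: y2)%R
      < Order.max (fval phi y1) (fval phi y2))%E.

Definition monotone_wrt B phi : Prop :=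
  forall y1 y2 : Y, dom phi y1 -> dom phi y2 -> B (y2 - y1) ->
    (fval phi y1 <= fval phi y2)%E.

Definition strictly_monotone_wrt B phi : Prop :=
  forall y1 y2 : Y, dom phi y1 -> dom phi y2 -> (B `\ 0) (y2 - y1) ->
    (fval phi y1 < fval phi y2)%E.

End nu_functions.

(* Main.v *)
Require Import Defs.
From HB Require Import structures.
From mathcomp Require Import all_boot all_order all_algebra.
From mathcomp Require Import all_classical all_reals all_analysis.
Set Implicit Arguments.
Unset Strict Implicit.
Unset Printing Implicit Defensive.
Import Order.TTheory GRing.Theory Num.Theory.
Import numFieldNormedType.Exports.
Local Open Scope classical_set_scope.
Local Open Scope ring_scope.

(** The heart of the matter is the identity
    phi_(A, lambda k) = (1 / lambda) phi_(A, k), which comes from the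
    substitution s = t lambda: y lies in t (lambda k) + A exactly when it lies
    in s k + A, so the set of admissible t is 1 / lambda times the set of
    admissible s, and a positive factor passes through the infimum
    ([phi_of_scale]). The empty set is scaled to the empty set, so the two
    functions take the value nu at the same points.

    Everything else is about an arbitrary function with values in the extended
    reals and nu, and its multiple by a positive real c. Such a multiple has the
    same domain, since c nu = nu, and its epigraph is the preimage of the
    original epigraph under the linear bijection (y, t) |-> (y, t / c)
    ([epi_scale]). Convexity, being a cone and closedness under sums all survive
    taking preimages under a linear map. The order-theoretic and topological
    properties survive because x |-> c x is an increasing continuous map of the
    extended reals, and the concave counterparts because scaling commutes with
    the change of sign. The algebraic identities (linear, odd, homogeneous) are
    multiplied by c on both sides. So each property passes from phi to c phi,
    and then back again because phi = (1 / c) (c phi) ([nu_scale_fun_iff]). *)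

(** * Preimages under linear maps *)

Section linear_preimage.
Context {R : realType} {V W : lmodType R}.
Variable f : {linear V -> W}.

Lemma convex_set_preimage (S : set W) :
  convex_set (M := W) S -> convex_set (M := V) (f @^-1` S).
Proof.
move=> cS x y t /set_mem Sx /set_mem Sy; apply/mem_set.
rewrite /conv /= linearD !linearZ.
exact/set_mem/(cS _ _ t (mem_set Sx) (mem_set Sy)).
Qed.

Lemma add_closed_preimage (S : set W) :
  [set p + q | p in S & q in S] `<=` S ->
  [set p + q | p in f @^-1` S & q in f @^-1` S] `<=` f @^-1` S.
Proof.
move=> addS _ [p Sp] [q Sq] <-; rewrite /preimage /= linearD.
by apply: addS; exists (f p) => //; exists (f q).
Qed.

Lemma cone_preimage (S : set W) : cone S -> cone (f @^-1` S).
Proof.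
by move=> cS a u a0 Su; rewrite /preimage /= linearZ; exact: cS.
Qed.

End linear_preimage.

(** * Positive multiples of functions with values in the extended reals and nu *)

Section nu_scale_fun.
Context {R : realType} {Y : topologicalLmodType R}.
Implicit Types (phi : Y -> nubar R) (c : R).

Definition nu_scale_fun c phi : Y -> nubar R := fun y => nu_scale c (phi y).

Lemma nu_scale_funK c phi :
  0 < c -> nu_scale_fun c^-1 (nu_scale_fun c phi) = phi.
Proof.
move=> c0; apply/funext => y; rewrite /nu_scale_fun /nu_scale.
by case: (phi y) => //= x; rewrite muleA -EFinM mulVf ?gt_eqF// mul1e.
Qed.

(** A property that survives all positive factors is unaffected by any of them,
    since dividing by c is again multiplication by a positive factor. *)
Lemma nu_scale_fun_iff (P : (Y -> nubar R) -> Prop) :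
  (forall c phi, 0 < c -> P phi -> P (nu_scale_fun c phi)) ->
  forall c phi, 0 < c -> (P (nu_scale_fun c phi) <-> P phi).
Proof.
move=> PS c phi c0; split; last exact: PS.
by rewrite -{2}(nu_scale_funK phi c0); apply: PS; rewrite invr_gt0.
Qed.

Lemma dom_scale c phi : dom (nu_scale_fun c phi) = dom phi.
Proof.
apply/seteqP; split => y; rewrite /dom /nu_scale_fun /=.
  by case: (phi y) => [x|] [] // *; exists x.
by move=> [x ->]; exists (c%:E * x)%E.
Qed.

(** This holds outside the domain as well: the default value 0 is its own
    multiple. *)
Lemma fval_scale c phi y : fval (nu_scale_fun c phi) y = (c%:E * fval phi y)%E.
Proof. by rewrite /fval /nu_scale_fun; case: (phi y) => //=; rewrite mule0. Qed.

Lemma opp_fun_scale c phi :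
  opp_fun (nu_scale_fun c phi) = nu_scale_fun c (opp_fun phi).
Proof.
apply/funext => y; rewrite /opp_fun /nu_scale_fun /nu_opp /nu_scale.
by case: (phi y) => //= x; rewrite muleN.
Qed.

(** ** Values and order *)

Lemma proper_scale c phi :
  0 < c -> nu_proper phi -> nu_proper (nu_scale_fun c phi).
Proof.
move=> c0 [D F]; split; first by rewrite dom_scale.
by move=> y; rewrite dom_scale fval_scale => /F fy; rewrite fin_numM.
Qed.

Lemma finite_valued_scale c phi :
  0 < c -> nu_finite_valued phi -> nu_finite_valued (nu_scale_fun c phi).
Proof.
by move=> c0 F y; have [r yr] := F y; exists (c * r); rewrite /nu_scale_fun yr.
Qed.

Lemma strictly_quasiconvex_scale c phi : 0 < c ->
  nu_strictly_quasiconvex phi -> nu_strictly_quasiconvex (nu_scale_fun c phi).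
Proof.
move=> c0 [cD qc]; split; first by rewrite dom_scale.
move=> y1 y2 t; rewrite dom_scale !fval_scale => d1 d2 y12 t0 t1.
by rewrite -maxe_pMr ?lte_pmul2l ?lte_fin ?lee_fin ?ltW//; exact: qc.
Qed.

Lemma monotone_scale B c phi :
  0 < c -> monotone_wrt B phi -> monotone_wrt B (nu_scale_fun c phi).
Proof.
move=> c0 mB y1 y2; rewrite dom_scale !fval_scale => d1 d2 By.
by rewrite lee_pmul2l ?lte_fin//; exact: mB.
Qed.

Lemma strictly_monotone_scale B c phi : 0 < c ->
  strictly_monotone_wrt B phi -> strictly_monotone_wrt B (nu_scale_fun c phi).
Proof.
move=> c0 mB y1 y2; rewrite dom_scale !fval_scale => d1 d2 By.
by rewrite lte_pmul2l ?lte_fin//; exact: mB.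
Qed.

(** ** Continuity *)

Lemma continuous_scale c phi :
  0 < c -> nu_continuous phi -> nu_continuous (nu_scale_fun c phi).
Proof.
move=> c0; rewrite /nu_continuous dom_scale => phic y.
have -> : fval (nu_scale_fun c phi) = (fun y => (c%:E * fval phi y)%E).
  by apply/funext => z; exact: fval_scale.
by apply: cvgeZl => //; exact: phic.
Qed.

Lemma lsc_scale c phi : 0 < c -> nu_lsc phi -> nu_lsc (nu_scale_fun c phi).
Proof.
move=> c0; rewrite /nu_lsc dom_scale => phic y a.
rewrite fval_scale muleC -lte_pdivrMr// => /(phic y (a / c)) [V nV Va].
exists V => // z /Va.
by rewrite fval_scale EFinM lte_pdivrMr// muleC.
Qed.

Lemma usc_scale c phi : 0 < c -> nu_usc phi -> nu_usc (nu_scale_fun c phi).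
Proof.
move=> c0; rewrite /nu_usc dom_scale => phic y a.
rewrite fval_scale muleC -lte_pdivlMr// => /(phic y (a / c)) [V nV Va].
exists V => // z /Va.
by rewrite fval_scale EFinM lte_pdivlMr// muleC.
Qed.

(** ** Properties of the epigraph *)

Definition contract_height c (p : Y * R^o) : Y * R^o := (p.1, c^-1 *: p.2).

Lemma contract_height_linear c : linear (contract_height c).
Proof.
move=> a p q; rewrite /contract_height /= scalerDr !scalerA (mulrC _ a).
by congr pair; rewrite -scalerA.
Qed.

HB.instance Definition _ c :=
  GRing.isLinear.Build R (Y * R^o)%type (Y * R^o)%type _ (contract_height c)
    (contract_height_linear c).

Lemma epi_scale c phi :
  0 < c -> epi (nu_scale_fun c phi) = contract_height c @^-1` epi phi.
Proof.
move=> c0; apply/seteqP.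
by split => -[y t]; rewrite /epi /contract_height /= dom_scale fval_scale;
  rewrite [_ *: _]mulrC EFinM lee_pdivlMr// muleC.
Qed.

Lemma convex_scale c phi :
  0 < c -> nu_convex phi -> nu_convex (nu_scale_fun c phi).
Proof.
move=> c0 [cD cE]; split; first by rewrite dom_scale.
by rewrite epi_scale//; exact: convex_set_preimage.
Qed.

Lemma subadditive_scale c phi :
  0 < c -> nu_subadditive phi -> nu_subadditive (nu_scale_fun c phi).
Proof.
move=> c0 [aD aE]; split; first by rewrite dom_scale.
by rewrite epi_scale//; exact: add_closed_preimage.
Qed.

Lemma pos_homogeneous_scale c phi :
  0 < c -> nu_pos_homogeneous phi -> nu_pos_homogeneous (nu_scale_fun c phi).
Proof.
move=> c0 [homD [[[y t] Eyt] cE]]; split; first by rewrite dom_scale.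
rewrite epi_scale//; split; last exact: cone_preimage.
exists (y, c *: t); rewrite /preimage /contract_height /=.
by rewrite scalerA mulVf ?gt_eqF// scale1r.
Qed.

Lemma concave_scale c phi :
  0 < c -> nu_concave phi -> nu_concave (nu_scale_fun c phi).
Proof. by move=> c0; rewrite /nu_concave opp_fun_scale; exact: convex_scale. Qed.

Lemma superadditive_scale c phi :
  0 < c -> nu_superadditive phi -> nu_superadditive (nu_scale_fun c phi).
Proof.
by move=> c0; rewrite /nu_superadditive opp_fun_scale; exact: subadditive_scale.
Qed.

Lemma affine_scale c phi :
  0 < c -> nu_affine phi -> nu_affine (nu_scale_fun c phi).
Proof.
by move=> c0 [cvx ccv]; split; [exact: convex_scale|exact: concave_scale].
Qed.

Lemma sublinear_scale c phi :
  0 < c -> nu_sublinear phi -> nu_sublinear (nu_scale_fun c phi).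
Proof.
move=> c0 [cvx hom].
by split; [exact: convex_scale|exact: pos_homogeneous_scale].
Qed.

(** ** Algebraic identities *)

Lemma linear_scale c phi :
  0 < c -> nu_linear phi -> nu_linear (nu_scale_fun c phi).
Proof.
by move=> c0 [f fE]; exists (c \*: f) => y; rewrite /nu_scale_fun fE.
Qed.

Lemma odd_scale c phi : 0 < c -> nu_odd phi -> nu_odd (nu_scale_fun c phi).
Proof.
move=> c0 [oD oE]; split; first by rewrite dom_scale.
move=> y; rewrite dom_scale /nu_scale_fun => /oE ->.
by rewrite /nu_opp /nu_scale; case: (phi y) => //= x; rewrite muleN.
Qed.

Lemma homogeneous_scale c phi :
  0 < c -> nu_homogeneous phi -> nu_homogeneous (nu_scale_fun c phi).
Proof.
move=> c0 hom y a; rewrite dom_scale => /(hom y a) [Day phiay]; split=> //.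
rewrite /nu_scale_fun phiay /nu_scale.
by case: (phi y) => //= x; rewrite muleCA.
Qed.

End nu_scale_fun.

(** * Rescaling the direction *)

Section direction.
Context {R : realType} {Y : topologicalLmodType R}.
Variables (A : set Y) (k : Y) (lambda : R).
Hypothesis lambda0 : 0 < lambda.

Lemma recession_cone_scale u :
  recession_cone A u -> recession_cone A (lambda *: u).
Proof.
move=> Au a Aa t t0; rewrite scalerA.
by apply: Au => //; rewrite mulr_ge0// ltW.
Qed.

(** Here t (lambda k) + A = (t lambda) k + A turns the infimum over t into
    1 / lambda times the infimum over s = t lambda. *)
Lemma phi_of_scale :
  phi_of A (lambda *: k) = nu_scale_fun (1 / lambda) (phi_of A k).
Proof.
have lambda_neq0 : lambda != 0 by rewrite gt_eqF.
apply/funext => y; rewrite /phi_of /nu_scale_fun /nu_inf div1r.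
set T := [set t | _ y]; set S := [set t | _ y].
have TS : T = *%R lambda^-1 @` S.
  apply/seteqP; split=> [t [a Aa ay]|_ [s [a Aa ay] <-]].
    exists (lambda * t); last by rewrite mulKf.
    by exists a => //; rewrite -ay scalerA mulrC.
  by exists a => //; rewrite -ay scalerA mulrAC mulVf// mul1r.
have TS0 : (T = set0) <-> (S = set0).
  by rewrite TS; split=> [|->]; [exact: image_set0_set0|exact: image_set0].
case: pselect => T0; case: pselect => //= S0.
- by case: S0; apply/TS0.
- by case: T0; apply/TS0.
congr Some; rewrite -ereal_inf_pZl ?invr_gt0// TS; congr ereal_inf.
by rewrite !image_comp.
Qed.

End direction.

Theorem proposition5 (R : realType) (Y : topologicalLmodType R) (A : set Y)
    (k : Y) (lambda : R)
    (hAclosed : closed A) (hAproper : proper_subset A)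
    (hk : ([set - u | u in recession_cone A] `\ 0) k)
    (hlambda : 0 < lambda) :
  ([set - u | u in recession_cone A] `\ 0) (lambda *: k) /\
  dom (phi_of A (lambda *: k)) = dom (phi_of A k) /\
  (forall y : Y,
    phi_of A (lambda *: k) y = nu_scale (1 / lambda) (phi_of A k y)) /\
  (nu_proper (phi_of A (lambda *: k)) <-> nu_proper (phi_of A k)) /\
  (nu_finite_valued (phi_of A (lambda *: k)) <->
    nu_finite_valued (phi_of A k)) /\
  (nu_continuous (phi_of A (lambda *: k)) <-> nu_continuous (phi_of A k)) /\
  (nu_lsc (phi_of A (lambda *: k)) <-> nu_lsc (phi_of A k)) /\
  (nu_usc (phi_of A (lambda *: k)) <-> nu_usc (phi_of A k)) /\
  (nu_convex (phi_of A (lambda *: k)) <-> nu_convex (phi_of A k)) /\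
  (nu_concave (phi_of A (lambda *: k)) <-> nu_concave (phi_of A k)) /\
  (nu_strictly_quasiconvex (phi_of A (lambda *: k)) <->
    nu_strictly_quasiconvex (phi_of A k)) /\
  (nu_subadditive (phi_of A (lambda *: k)) <-> nu_subadditive (phi_of A k)) /\
  (nu_superadditive (phi_of A (lambda *: k)) <->
    nu_superadditive (phi_of A k)) /\
  (nu_affine (phi_of A (lambda *: k)) <-> nu_affine (phi_of A k)) /\
  (nu_linear (phi_of A (lambda *: k)) <-> nu_linear (phi_of A k)) /\
  (nu_sublinear (phi_of A (lambda *: k)) <-> nu_sublinear (phi_of A k)) /\
  (nu_pos_homogeneous (phi_of A (lambda *: k)) <->
    nu_pos_homogeneous (phi_of A k)) /\
  (nu_odd (phi_of A (lambda *: k)) <-> nu_odd (phi_of A k)) /\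
  (nu_homogeneous (phi_of A (lambda *: k)) <-> nu_homogeneous (phi_of A k)) /\
  (forall B : set Y,
    (monotone_wrt B (phi_of A k) ->
      monotone_wrt B (phi_of A (lambda *: k))) /\
    (strictly_monotone_wrt B (phi_of A k) ->
      strictly_monotone_wrt B (phi_of A (lambda *: k)))).
Proof.
have invl0 : 0 < 1 / lambda by rewrite divr_gt0.
split.
  move: hk => [[u Au uk] kn0]; split.
    by exists (lambda *: u); [exact: recession_cone_scale|rewrite -scalerN uk].
  by move/eqP; rewrite scaler_eq0 gt_eqF//= => /eqP.
rewrite phi_of_scale//; split; first exact: dom_scale.
split; first by [].
split; first exact: (nu_scale_fun_iff proper_scale).
split; first exact: (nu_scale_fun_iff finite_valued_scale).
split; first exact: (nu_scale_fun_iff continuous_scale).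
split; first exact: (nu_scale_fun_iff lsc_scale).
split; first exact: (nu_scale_fun_iff usc_scale).
split; first exact: (nu_scale_fun_iff convex_scale).
split; first exact: (nu_scale_fun_iff concave_scale).
split; first exact: (nu_scale_fun_iff strictly_quasiconvex_scale).
split; first exact: (nu_scale_fun_iff subadditive_scale).
split; first exact: (nu_scale_fun_iff superadditive_scale).
split; first exact: (nu_scale_fun_iff affine_scale).
split; first exact: (nu_scale_fun_iff linear_scale).
split; first exact: (nu_scale_fun_iff sublinear_scale).
split; first exact: (nu_scale_fun_iff pos_homogeneous_scale).
split; first exact: (nu_scale_fun_iff odd_scale).
split; first exact: (nu_scale_fun_iff homogeneous_scale).
by move=> B; split; [exact: monotone_scale|exact: strictly_monotone_scale].
Qed.
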